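(* Let $(\mathcal{C},\otimes,1)$ be a monoidal category which has coequalizers and in which every object is coflat. Let $\varphi:R\to S$ be an algebra morphism in $\mathcal{C}$. Then the following assertions are equivalent: (i) $\varphi$ is a split-epi as an $R$-bimodule morphism in $\mathcal{C}$, i.e. there exists an $R$-bimodule morphism $E:S\to R$ in $\mathcal{C}$ such that $\varphi\circ E=\mathrm{Id}_S$; (ii) $\varphi$ is an epimorphism and there exists an $R$-bimodule morphism $E:S\to R$ in $\mathcal{C}$ such that $\varphi\circ E\circ u_S=u_S$. If one of these equivalent conditions holds, then (iii) the induction functor $\varphi^*=-\otimes_R S:\mathcal{C}_R\to\mathcal{C}_S$ is naturally full. Moreover, if $1$ is a left $\otimes$-generator in $\mathcal{C}$, then (iii) is equivalent to (i) and (ii).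
   Context: Associativity and unit constraints are suppressed. For an algebra $A$ in a monoidal category $\mathcal{C}$, $m_A$ and $u_A:1\to A$ are its multiplication and unit, and $\mathcal{C}_A$ (resp. ${}_A\mathcal{C}$) is the category of right (resp. left) $A$-modules in $\mathcal{C}$. An object $X$ is coflat if both functors $X\otimes-$ and $-\otimes X$ preserve coequalizers. For $M\in\mathcal{C}_A$ with action $\nu:M\otimes A\to M$ and $X\in{}_A\mathcal{C}$ with action $\mu:A\otimes X\to X$, $q^A_{M,X}:M\otimes X\to M\otimes_A X$ denotes the coequalizer of $\nu\otimes\mathrm{Id}_X$ and $\mathrm{Id}_M\otimes\mu$. Given an algebra morphism $\varphi:R\to S$, $S$ is an $R$-bimodule via $m_S(\varphi\otimes\mathrm{Id}_S)$ and $m_S(\mathrm{Id}_S\otimes\varphi)$. The induction functor $\varphi^*=-\otimes_R S:\mathcal{C}_R\to\mathcal{C}_S$ sends $X$ to $X\otimes_R S$, with right $S$-action determined by $\nu\,(q^R_{X,S}\otimes\mathrm{Id}_S)=q^R_{X,S}(\mathrm{Id}_X\otimes m_S)$, and sends $f:X\to Y$ to the unique morphism $f\otimes_R S$ with $(f\otimes_R S)q^R_{X,S}=q^R_{Y,S}(f\otimes\mathrm{Id}_S)$. An object $P$ is a left $\otimes$-generator of $\mathcal{C}$ if for any morphisms $f,g:Y\otimes Z\to W$ in $\mathcal{C}$ with $f(\varepsilon\otimes\mathrm{Id}_Z)=g(\varepsilon\otimes\mathrm{Id}_Z)$ for all $\varepsilon:P\to Y$ in $\mathcal{C}$, one has $f=g$.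 A functor $F:\mathcal{A}\to\mathcal{B}$ induces the natural transformation $\mathcal{F}:\mathrm{Hom}_{\mathcal{A}}(-,-)\to\mathrm{Hom}_{\mathcal{B}}(F-,F-)$, $f\mapsto F(f)$. $F$ is naturally full if there is a natural transformation $\mathcal{P}:\mathrm{Hom}_{\mathcal{B}}(F-,F-)\to\mathrm{Hom}_{\mathcal{A}}(-,-)$ with $\mathcal{F}\circ\mathcal{P}=\mathrm{Id}$. *)

(* Defs.v *)
From Stdlib Require Import ssreflect ssrfun.
From Stdlib Require Import ProofIrrelevance IndefiniteDescription.

Set Implicit Arguments.
Unset Strict Implicit.
Unset Printing Implicit Defensive.

Declare Scope cat_scope.
Delimit Scope cat_scope with cat.
Local Open Scope cat_scope.

Reserved Notation "g ∘ f" (at level 40, left associativity).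
Reserved Notation "X ⊗ Y" (at level 38, left associativity).
Reserved Notation "f ⊗ₘ g" (at level 38, left associativity).

Record category := Category {
  ob :> Type;
  hom : ob -> ob -> Type;
  idm : forall X, hom X X;
  comp : forall X Y Z, hom Y Z -> hom X Y -> hom X Z;
  comp1m : forall X Y (f : hom X Y), comp (idm Y) f = f;
  compm1 : forall X Y (f : hom X Y), comp f (idm X) = f;
  compA : forall X Y Z W (h : hom Z W) (g : hom Y Z) (f : hom X Y),
    comp h (comp g f) = comp (comp h g) f
}.
Arguments hom {c} X Y.
Arguments idm {c} X.
Arguments comp {c X Y Z} g f : rename.
Notation "g ∘ f" := (comp g f) : cat_scope.

Record functor (A B : category) := Functor {
  fob :> A -> B;
  fmap : forall X Y, hom X Y -> hom (fob X) (fob Y);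
  fmap1 : forall X, fmap (idm X) = idm (fob X);
  fmapD : forall X Y Z (g : hom Y Z) (f : hom X Y),
    fmap (g ∘ f) = fmap g ∘ fmap f
}.
Arguments fmap {A B} F {X Y} f : rename.

Definition epi (C : category) (X Y : C) (f : hom X Y) : Prop :=
  forall Z (g h : hom Y Z), g ∘ f = h ∘ f -> g = h.

(* The two clauses after the existential say that P, with components
   Hom_B (F X, F Y) -> Hom_A (X, Y), is natural in both variables and that it
   is a right inverse of f |-> F f. *)
Definition naturally_full (A B : category) (F : functor A B) : Prop :=
  exists P : forall X Y : A, hom (F X) (F Y) -> hom X Y,
    (forall (X X' Y Y' : A) (h : hom X' X) (k : hom Y Y')
        (f : hom (F X) (F Y)),
        P X' Y' (fmap F k ∘ f ∘ fmap F h) = k ∘ P X Y f ∘ h) /\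
    (forall (X Y : A) (f : hom (F X) (F Y)), fmap F (P X Y f) = f).

Definition is_coequalizer (C : category) (X Y Q : C) (f g : hom X Y)
    (q : hom Y Q) : Prop :=
  q ∘ f = q ∘ g /\
  forall W (h : hom Y W), h ∘ f = h ∘ g -> exists! k : hom Q W, k ∘ q = h.

Record coequalizer (C : category) (X Y : C) (f g : hom X Y) := Coequalizer {
  coeq_ob :> C;
  coeq_map : hom Y coeq_ob;
  coeqP : is_coequalizer f g coeq_map
}.

(* A choice of coequalizers, so that the tensor product over an algebra is an
   object and not just an isomorphism class. *)
Definition has_coequalizers (C : category) : Type :=
  forall (X Y : C) (f g : hom X Y), coequalizer f g.

Definition preserves_coequalizers (A B : category) (F : functor A B) : Prop :=
  forall (X Y Q : A) (f g : hom X Y) (q : hom Y Q),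
    is_coequalizer f g q -> is_coequalizer (fmap F f) (fmap F g) (fmap F q).

Definition coeq_desc (C : category) (X Y Q W : C) (f g : hom X Y)
    (q : hom Y Q) (cq : is_coequalizer f g q) (h : hom Y W)
    (e : h ∘ f = h ∘ g) : hom Q W :=
  proj1_sig (constructive_indefinite_description _ (proj2 cq W h e)).

Lemma coeq_descE (C : category) (X Y Q W : C) (f g : hom X Y)
    (q : hom Y Q) (cq : is_coequalizer f g q) (h : hom Y W)
    (e : h ∘ f = h ∘ g) : coeq_desc cq e ∘ q = h.
Proof.
exact: (proj1 (proj2_sig (constructive_indefinite_description _ (proj2 cq W h e)))).
Qed.

Lemma coeq_epi (C : category) (X Y Q : C) (f g : hom X Y) (q : hom Y Q) :
  is_coequalizer f g q -> epi q.
Proof.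
move=> [e cq] W k l kl.
have e' : (k ∘ q) ∘ f = (k ∘ q) ∘ g by rewrite -!compA e.
have [m [_ um]] := cq W (k ∘ q) e'.
by rewrite -(um k) // -(um l).
Qed.

Record monoidal := Monoidal {
  mcat :> category;
  tens : mcat -> mcat -> mcat;
  tensm : forall X X' Y Y' : mcat,
    hom X X' -> hom Y Y' -> hom (tens X Y) (tens X' Y');
  tens_id : forall X Y : mcat, tensm (idm X) (idm Y) = idm (tens X Y);
  tens_comp : forall (X X' X'' Y Y' Y'' : mcat)
      (f' : hom X' X'') (f : hom X X') (g' : hom Y' Y'') (g : hom Y Y'),
    tensm (f' ∘ f) (g' ∘ g) = tensm f' g' ∘ tensm f g;
  munit : mcat;
  assoc : forall X Y Z : mcat, hom (tens (tens X Y) Z) (tens X (tens Y Z));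
  assoc_inv : forall X Y Z : mcat, hom (tens X (tens Y Z)) (tens (tens X Y) Z);
  assocK : forall X Y Z, assoc_inv X Y Z ∘ assoc X Y Z = idm _;
  assoc_invK : forall X Y Z, assoc X Y Z ∘ assoc_inv X Y Z = idm _;
  assoc_nat : forall (X X' Y Y' Z Z' : mcat)
      (f : hom X X') (g : hom Y Y') (h : hom Z Z'),
    assoc X' Y' Z' ∘ tensm (tensm f g) h = tensm f (tensm g h) ∘ assoc X Y Z;
  lunit : forall X : mcat, hom (tens munit X) X;
  lunit_inv : forall X : mcat, hom X (tens munit X);
  lunitK : forall X, lunit_inv X ∘ lunit X = idm _;
  lunit_invK : forall X, lunit X ∘ lunit_inv X = idm _;
  lunit_nat : forall (X Y : mcat) (f : hom X Y),
    lunit Y ∘ tensm (idm munit) f = f ∘ lunit X;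
  runit : forall X : mcat, hom (tens X munit) X;
  runit_inv : forall X : mcat, hom X (tens X munit);
  runitK : forall X, runit_inv X ∘ runit X = idm _;
  runit_invK : forall X, runit X ∘ runit_inv X = idm _;
  runit_nat : forall (X Y : mcat) (f : hom X Y),
    runit Y ∘ tensm f (idm munit) = f ∘ runit X;
  pentagon : forall X Y Z W : mcat,
    assoc X Y (tens Z W) ∘ assoc (tens X Y) Z W
    = tensm (idm X) (assoc Y Z W) ∘ assoc X (tens Y Z) W
        ∘ tensm (assoc X Y Z) (idm W);
  triangle : forall X Y : mcat,
    tensm (idm X) (lunit Y) ∘ assoc X munit Y = tensm (runit X) (idm Y)
}.
Arguments tens {m} X Y.
Arguments tensm {m X X' Y Y'} f g.
Arguments munit m : clear implicits.
Arguments assoc {m} X Y Z.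
Arguments assoc_inv {m} X Y Z.
Arguments lunit {m} X.
Arguments lunit_inv {m} X.
Arguments runit {m} X.
Arguments runit_inv {m} X.
Notation "X ⊗ Y" := (tens X Y) : cat_scope.
Notation "f ⊗ₘ g" := (tensm f g) : cat_scope.

Lemma tens_compl (C : monoidal) (X X' X'' Z : C)
    (f' : hom X' X'') (f : hom X X') :
  (f' ∘ f) ⊗ₘ idm Z = (f' ⊗ₘ idm Z) ∘ (f ⊗ₘ idm Z).
Proof. by rewrite -tens_comp comp1m. Qed.

Lemma tens_compr (C : monoidal) (X X' X'' Z : C)
    (f' : hom X' X'') (f : hom X X') :
  idm Z ⊗ₘ (f' ∘ f) = (idm Z ⊗ₘ f') ∘ (idm Z ⊗ₘ f).
Proof. by rewrite -tens_comp comp1m. Qed.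

Lemma tens_swap (C : monoidal) (X X' Y Y' : C) (f : hom X X') (g : hom Y Y') :
  (f ⊗ₘ idm Y') ∘ (idm X ⊗ₘ g) = (idm X' ⊗ₘ g) ∘ (f ⊗ₘ idm Y).
Proof. by rewrite -!tens_comp !comp1m !compm1. Qed.

Lemma assoc_natl (C : monoidal) (X X' Y Z : C) (f : hom X X') :
  assoc X' Y Z ∘ ((f ⊗ₘ idm Y) ⊗ₘ idm Z) = (f ⊗ₘ idm (Y ⊗ Z)) ∘ assoc X Y Z.
Proof. by rewrite assoc_nat tens_id. Qed.

Lemma assoc_natr (C : monoidal) (X Y Z Z' : C) (h : hom Z Z') :
  assoc X Y Z' ∘ (idm (X ⊗ Y) ⊗ₘ h) = (idm X ⊗ₘ (idm Y ⊗ₘ h)) ∘ assoc X Y Z.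
Proof. by rewrite -tens_id assoc_nat. Qed.

Lemma runit_tens (C : monoidal) (X Y : C) :
  (idm X ⊗ₘ runit Y) ∘ assoc X Y (munit C) = runit (X ⊗ Y).
Proof.
have faithful (Z W : C) (f g : hom Z W) :
    f ⊗ₘ idm (munit C) = g ⊗ₘ idm (munit C) -> f = g.
  move=> e; rewrite -(compm1 f) -(compm1 g) -(runit_invK Z) !compA.
  by rewrite -!runit_nat e.
apply: faithful; rewrite tens_compl.
set l := (X in X = _); set r := (X in _ = X).
rewrite -(comp1m l) -(comp1m r) -(assocK X Y (munit C)) -!compA.
congr (_ ∘ _); rewrite /l /r {l r} -triangle.
rewrite !compA assoc_nat assoc_natr -!compA pentagon !compA -tens_compr.
by rewrite triangle.
Qed.

Definition tensl (C : monoidal) (X : C) : functor C C :=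
  @Functor C C (fun Y => X ⊗ Y) (fun _ _ f => idm X ⊗ₘ f)
    (fun Y => tens_id X Y) (fun _ _ _ g f => tens_compr X g f).

Definition tensr (C : monoidal) (X : C) : functor C C :=
  @Functor C C (fun Y => Y ⊗ X) (fun _ _ f => f ⊗ₘ idm X)
    (fun Y => tens_id Y X) (fun _ _ _ g f => tens_compl X g f).

Definition coflat (C : monoidal) (X : C) : Prop :=
  preserves_coequalizers (tensl X) /\ preserves_coequalizers (tensr X).

Definition left_tensor_generator (C : monoidal) (P : C) : Prop :=
  forall (Y Z W : C) (f g : hom (Y ⊗ Z) W),
    (forall eps : hom P Y, f ∘ (eps ⊗ₘ idm Z) = g ∘ (eps ⊗ₘ idm Z)) -> f = g.

Record algebra (C : monoidal) := Algebra {
  alg_ob :> C;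
  mul : hom (alg_ob ⊗ alg_ob) alg_ob;
  one : hom (munit C) alg_ob;
  mul_assoc :
    mul ∘ (mul ⊗ₘ idm alg_ob)
    = mul ∘ (idm alg_ob ⊗ₘ mul) ∘ assoc alg_ob alg_ob alg_ob;
  mul_onel : mul ∘ (one ⊗ₘ idm alg_ob) = lunit alg_ob;
  mul_oner : mul ∘ (idm alg_ob ⊗ₘ one) = runit alg_ob
}.
Arguments mul {C} A : rename.
Arguments one {C} A : rename.

Record alg_hom (C : monoidal) (R S : algebra C) := AlgHom {
  alg_map :> hom R S;
  alg_mapM : alg_map ∘ mul R = mul S ∘ (alg_map ⊗ₘ alg_map);
  alg_map1 : alg_map ∘ one R = one S
}.

Record rmodule (C : monoidal) (A : algebra C) := RModule {
  rm_ob :> C;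
  ract : hom (rm_ob ⊗ A) rm_ob;
  ract_assoc :
    ract ∘ (ract ⊗ₘ idm A) = ract ∘ (idm rm_ob ⊗ₘ mul A) ∘ assoc rm_ob A A;
  ract_one : ract ∘ (idm rm_ob ⊗ₘ one A) = runit rm_ob
}.
Arguments ract {C A} M : rename.

Record lmodule (C : monoidal) (A : algebra C) := LModule {
  lm_ob :> C;
  lact : hom (A ⊗ lm_ob) lm_ob;
  lact_assoc :
    lact ∘ (mul A ⊗ₘ idm lm_ob) = lact ∘ (idm A ⊗ₘ lact) ∘ assoc A A lm_ob;
  lact_one : lact ∘ (one A ⊗ₘ idm lm_ob) = lunit lm_ob
}.
Arguments lact {C A} X : rename.

Record bimodule (C : monoidal) (A B : algebra C) := Bimodule {
  bm_left :> lmodule A;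
  bm_ract : hom (bm_left ⊗ B) bm_left;
  bm_ract_assoc :
    bm_ract ∘ (bm_ract ⊗ₘ idm B)
    = bm_ract ∘ (idm (bm_left : C) ⊗ₘ mul B) ∘ assoc (bm_left : C) B B;
  bm_ract_one : bm_ract ∘ (idm (bm_left : C) ⊗ₘ one B) = runit (bm_left : C);
  bm_compat :
    bm_ract ∘ (lact bm_left ⊗ₘ idm B)
    = lact bm_left ∘ (idm A ⊗ₘ bm_ract) ∘ assoc A (bm_left : C) B
}.
Arguments bm_ract {C A B} M : rename.

Record bimod_hom (C : monoidal) (A B : algebra C) (M N : bimodule A B) :=
    BimodHom {
  bimod_map :> hom (M : C) (N : C);
  bimod_mapl : bimod_map ∘ lact M = lact N ∘ (idm A ⊗ₘ bimod_map);
  bimod_mapr : bimod_map ∘ bm_ract M = bm_ract N ∘ (bimod_map ⊗ₘ idm B)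
}.

Definition regular_lmodule (C : monoidal) (R : algebra C) : lmodule R :=
  LModule (mul_assoc R) (mul_onel R).

Definition regular_bimodule (C : monoidal) (R : algebra C) : bimodule R R :=
  @Bimodule C R R (regular_lmodule R) (mul R)
    (mul_assoc R) (mul_oner R) (mul_assoc R).

Lemma restr_lact_assoc (C : monoidal) (R S : algebra C) (phi : alg_hom R S) :
  mul S ∘ (phi ⊗ₘ idm S) ∘ (mul R ⊗ₘ idm S)
  = mul S ∘ (phi ⊗ₘ idm S) ∘ (idm R ⊗ₘ (mul S ∘ (phi ⊗ₘ idm S)))
      ∘ assoc R R S.
Proof.
rewrite -(compA (mul S)) -tens_compl alg_mapM tens_compl compA mul_assoc.
rewrite -compA assoc_nat -!compA; congr (_ ∘ _); rewrite !compA.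
by congr (_ ∘ _); rewrite -!tens_comp !comp1m !compm1.
Qed.

Lemma restr_lact_one (C : monoidal) (R S : algebra C) (phi : alg_hom R S) :
  mul S ∘ (phi ⊗ₘ idm S) ∘ (one R ⊗ₘ idm S) = lunit S.
Proof. by rewrite -compA -tens_compl alg_map1 mul_onel. Qed.

Definition restr_lmodule (C : monoidal) (R S : algebra C) (phi : alg_hom R S) :
    lmodule R :=
  LModule (restr_lact_assoc phi) (restr_lact_one phi).

Lemma restr_ract_assoc (C : monoidal) (R S : algebra C) (phi : alg_hom R S) :
  mul S ∘ (idm S ⊗ₘ phi) ∘ ((mul S ∘ (idm S ⊗ₘ phi)) ⊗ₘ idm R)
  = mul S ∘ (idm S ⊗ₘ phi) ∘ (idm S ⊗ₘ mul R) ∘ assoc S R R.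
Proof.
rewrite -(compA (mul S) _ (_ ⊗ₘ mul R)) -tens_compr alg_mapM tens_compr !compA.
rewrite -(compA _ _ (assoc S R R)) -assoc_nat !compA -mul_assoc -!compA.
by congr (_ ∘ _); rewrite -!tens_comp !comp1m !compm1.
Qed.

Lemma restr_ract_one (C : monoidal) (R S : algebra C) (phi : alg_hom R S) :
  mul S ∘ (idm S ⊗ₘ phi) ∘ (idm S ⊗ₘ one R) = runit S.
Proof. by rewrite -compA -tens_compr alg_map1 mul_oner. Qed.

Lemma restr_compat (C : monoidal) (R S : algebra C) (phi : alg_hom R S) :
  mul S ∘ (idm S ⊗ₘ phi) ∘ ((mul S ∘ (phi ⊗ₘ idm S)) ⊗ₘ idm R)
  = mul S ∘ (phi ⊗ₘ idm S) ∘ (idm R ⊗ₘ (mul S ∘ (idm S ⊗ₘ phi)))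
      ∘ assoc R S R.
Proof.
transitivity (mul S ∘ (mul S ⊗ₘ idm S) ∘ ((phi ⊗ₘ idm S) ⊗ₘ phi)).
  by rewrite -!compA -!tens_comp !comp1m !compm1.
rewrite mul_assoc -compA assoc_nat !compA -!(compA (mul S)).
by rewrite -!tens_comp !comp1m !compm1.
Qed.

Definition restr_bimodule (C : monoidal) (R S : algebra C)
    (phi : alg_hom R S) : bimodule R R :=
  @Bimodule C R R (restr_lmodule phi) (mul S ∘ (idm S ⊗ₘ phi))
    (restr_ract_assoc phi) (restr_ract_one phi) (restr_compat phi).

Record rmod_hom (C : monoidal) (A : algebra C) (M N : rmodule A) := RModHom {
  rmod_map :> hom (M : C) (N : C);
  rmod_mapP : rmod_map ∘ ract M = ract N ∘ (rmod_map ⊗ₘ idm A)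
}.

Lemma rmod_hom_eq (C : monoidal) (A : algebra C) (M N : rmodule A)
    (f g : rmod_hom M N) : rmod_map f = rmod_map g -> f = g.
Proof.
case: f g => [f pf] [g pg] /= e; case: _ / e pg => pg.
by rewrite (proof_irrelevance _ pf pg).
Qed.

Lemma rmod_id_subproof (C : monoidal) (A : algebra C) (M : rmodule A) :
  idm (M : C) ∘ ract M = ract M ∘ (idm (M : C) ⊗ₘ idm A).
Proof. by rewrite tens_id comp1m compm1. Qed.

Lemma rmod_comp_subproof (C : monoidal) (A : algebra C) (M N P : rmodule A)
    (g : rmod_hom N P) (f : rmod_hom M N) :
  (g ∘ f) ∘ ract M = ract P ∘ ((g ∘ f) ⊗ₘ idm A).
Proof. by rewrite -compA rmod_mapP !compA rmod_mapP -!compA tens_compl. Qed.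

Definition rmod_id (C : monoidal) (A : algebra C) (M : rmodule A) :
    rmod_hom M M := RModHom (rmod_id_subproof M).

Definition rmod_comp (C : monoidal) (A : algebra C) (M N P : rmodule A)
    (g : rmod_hom N P) (f : rmod_hom M N) : rmod_hom M P :=
  RModHom (rmod_comp_subproof g f).

Definition rmodules (C : monoidal) (A : algebra C) : category.
Proof.
refine (@Category (rmodule A) (@rmod_hom C A) (@rmod_id C A)
  (@rmod_comp C A) _ _ _).
- by move=> M N f; apply: rmod_hom_eq; apply: comp1m.
- by move=> M N f; apply: rmod_hom_eq; apply: compm1.
- by move=> M N P Q h g f; apply: rmod_hom_eq; apply: compA.
Defined.

Definition tens_over (C : monoidal) (Q : has_coequalizers C) (A : algebra C)
    (M : rmodule A) (X : lmodule A) :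
    coequalizer (ract M ⊗ₘ idm (X : C))
      ((idm (M : C) ⊗ₘ lact X) ∘ assoc (M : C) A X) :=
  Q _ _ _ _.

Definition tens_over_map (C : monoidal) (Q : has_coequalizers C)
    (A : algebra C) (M : rmodule A) (X : lmodule A) :
    hom ((M : C) ⊗ X) (tens_over Q M X) :=
  coeq_map (tens_over Q M X).

Lemma tens_overE (C : monoidal) (Q : has_coequalizers C)
    (A : algebra C) (M : rmodule A) (X : lmodule A) :
  tens_over_map Q M X ∘ (ract M ⊗ₘ idm (X : C))
  = tens_over_map Q M X ∘ ((idm (M : C) ⊗ₘ lact X) ∘ assoc (M : C) A X).
Proof. exact: (proj1 (coeqP (tens_over Q M X))). Qed.

Lemma restr_lact_mul (C : monoidal) (R S : algebra C) (phi : alg_hom R S) :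
  mul S ∘ (lact (restr_lmodule phi) ⊗ₘ idm S)
  = lact (restr_lmodule phi) ∘ (idm R ⊗ₘ mul S) ∘ assoc R S S.
Proof.
rewrite /= tens_compl compA mul_assoc -!compA; congr (_ ∘ _).
by rewrite assoc_natl !compA tens_swap.
Qed.

Lemma ind_act_coeq_aux (C : monoidal) (R S : algebra C) (phi : alg_hom R S)
    (X : rmodule R) (T : C) (q : hom ((X : C) ⊗ S) T)
    (mu := lact (restr_lmodule phi) : hom (R ⊗ S) S) :
  q ∘ (ract X ⊗ₘ idm S) = q ∘ ((idm (X : C) ⊗ₘ mu) ∘ assoc (X : C) R S) ->
  q ∘ (idm (X : C) ⊗ₘ mul S) ∘ assoc (X : C) S S
    ∘ ((ract X ⊗ₘ idm S) ⊗ₘ idm S)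
  = q ∘ (idm (X : C) ⊗ₘ mul S) ∘ assoc (X : C) S S
    ∘ (((idm (X : C) ⊗ₘ mu) ∘ assoc (X : C) R S) ⊗ₘ idm S).
Proof.
move=> qE; have mE : mul S ∘ (mu ⊗ₘ idm S) = mu ∘ (idm R ⊗ₘ mul S) ∘ assoc R S S.
  exact: restr_lact_mul.
move: mu qE mE => mu qE mE.
rewrite -(compA _ (assoc _ _ _)) assoc_natl !compA.
rewrite -(compA q) -tens_swap compA qE.
rewrite tens_compl !compA -(compA _ (assoc _ _ _) (_ ⊗ₘ idm S)) assoc_nat !compA.
rewrite -(compA q (_ ⊗ₘ mul S)) -tens_compr mE !tens_compr !compA.
rewrite -(compA _ (assoc _ _ _) (_ ⊗ₘ mul S)) assoc_natr !compA -!compA.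
by do 3! congr (_ ∘ _); rewrite pentagon -!compA.
Qed.

Section Induction.
Variables (C : monoidal) (Q : has_coequalizers C) (cf : forall X : C, coflat X).
Variables (R S : algebra C) (phi : alg_hom R S).

Let tS (X : rmodule R) : C := tens_over Q X (restr_lmodule phi).
Let q (X : rmodule R) : hom ((X : C) ⊗ S) (tS X) :=
  tens_over_map Q X (restr_lmodule phi).

Lemma q_epi X : epi (q X).
Proof. exact: coeq_epi (coeqP _). Qed.

Lemma q_tens_coeq (X : rmodule R) :
  is_coequalizer ((ract X ⊗ₘ idm S) ⊗ₘ idm S)
    (((idm (X : C) ⊗ₘ lact (restr_lmodule phi)) ∘ assoc (X : C) R S) ⊗ₘ idm S)
    (q X ⊗ₘ idm S).
Proof. exact: (proj2 (cf S) _ _ _ _ _ _ (coeqP (tens_over Q X (restr_lmodule phi)))). Qed.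

Lemma q_tens_epi (X : rmodule R) (Z : C) : epi (q X ⊗ₘ idm Z).
Proof.
exact: coeq_epi
  (proj2 (cf Z) _ _ _ _ _ _ (coeqP (tens_over Q X (restr_lmodule phi)))).
Qed.

Lemma q_tens2_epi (X : rmodule R) : epi ((q X ⊗ₘ idm S) ⊗ₘ idm S).
Proof. exact: coeq_epi (proj2 (cf S) _ _ _ _ _ _ (q_tens_coeq X)). Qed.

(* The right S-action nu on X ⊗_R S, determined by [ind_actE]. *)
Definition ind_act (X : rmodule R) : hom (tS X ⊗ S) (tS X) :=
  coeq_desc (q_tens_coeq X)
    (ind_act_coeq_aux (tens_overE Q X (restr_lmodule phi))).

Lemma ind_actE (X : rmodule R) :
  ind_act X ∘ (q X ⊗ₘ idm S)
  = q X ∘ (idm (X : C) ⊗ₘ mul S) ∘ assoc (X : C) S S.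
Proof. exact: coeq_descE. Qed.

Lemma ind_act_assoc (X : rmodule R) :
  ind_act X ∘ (ind_act X ⊗ₘ idm S)
  = ind_act X ∘ (idm (tS X) ⊗ₘ mul S) ∘ assoc (tS X) S S.
Proof.
apply: (@q_tens2_epi X).
rewrite -[LHS]compA -tens_compl ind_actE !tens_compl !compA ind_actE.
rewrite -[in RHS](compA _ (assoc _ _ _)) assoc_natl.
rewrite !compA -[in RHS](compA (ind_act X)) -tens_swap !compA ind_actE.
rewrite -[in RHS](compA _ (assoc _ _ _) (_ ⊗ₘ mul S)) assoc_natr !compA.
rewrite -[in RHS](compA _ (assoc _ _ _)) pentagon !compA.
rewrite -[in LHS](compA _ (assoc _ _ _) (_ ⊗ₘ idm S)) assoc_nat !compA.
rewrite -!compA; congr (_ ∘ _); rewrite !compA.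
by do 2! congr (_ ∘ _); rewrite -!tens_compr mul_assoc.
Qed.

Lemma ind_act_one (X : rmodule R) :
  ind_act X ∘ (idm (tS X) ⊗ₘ one S) = runit (tS X).
Proof.
apply: (@q_tens_epi X).
rewrite runit_nat -compA -tens_swap compA ind_actE -compA assoc_natr.
by rewrite -!compA !(compA (_ ⊗ₘ mul S)) -tens_compr mul_oner runit_tens.
Qed.

Definition ind_ob (X : rmodule R) : rmodule S :=
  RModule (ind_act_assoc X) (ind_act_one X).

Lemma ind_map_coeq (X Y : rmodule R) (f : rmod_hom X Y) :
  q Y ∘ (f ⊗ₘ idm S) ∘ (ract X ⊗ₘ idm S)
  = q Y ∘ (f ⊗ₘ idm S)
      ∘ ((idm (X : C) ⊗ₘ lact (restr_lmodule phi)) ∘ assoc (X : C) R S).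
Proof.
rewrite -compA -tens_compl rmod_mapP tens_compl compA.
rewrite [q Y ∘ (ract Y ⊗ₘ _)](tens_overE Q Y (restr_lmodule phi)).
by rewrite -!compA; congr (_ ∘ _); rewrite assoc_natl !compA tens_swap.
Qed.

(* f ⊗_R S, determined by [ind_mapE] *)
Definition ind_map (X Y : rmodule R) (f : rmod_hom X Y) : hom (tS X) (tS Y) :=
  coeq_desc (coeqP (tens_over Q X (restr_lmodule phi))) (ind_map_coeq f).

Lemma ind_mapE (X Y : rmodule R) (f : rmod_hom X Y) :
  ind_map f ∘ q X = q Y ∘ (f ⊗ₘ idm S).
Proof. exact: coeq_descE. Qed.

Lemma ind_map_act (X Y : rmodule R) (f : rmod_hom X Y) :
  ind_map f ∘ ract (ind_ob X) = ract (ind_ob Y) ∘ (ind_map f ⊗ₘ idm S).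
Proof.
apply: (@q_tens_epi X); rewrite /= -!compA ind_actE -tens_compl ind_mapE.
rewrite tens_compl !compA ind_actE ind_mapE -[RHS]compA assoc_natl.
by rewrite !compA -!(compA (q Y)) tens_swap.
Qed.

Definition ind_hom (X Y : rmodule R) (f : rmod_hom X Y) :
    rmod_hom (ind_ob X) (ind_ob Y) :=
  @RModHom C S (ind_ob X) (ind_ob Y) (ind_map f) (ind_map_act f).

Definition induction : functor (rmodules R) (rmodules S).
Proof.
refine (@Functor (rmodules R) (rmodules S) ind_ob ind_hom _ _).
- move=> X; apply: rmod_hom_eq; apply: (@q_epi X).
  by rewrite /= ind_mapE /= tens_id comp1m compm1.
- move=> X Y Z g f; apply: rmod_hom_eq; apply: (@q_epi X).
  by rewrite /= -compA !ind_mapE /= tens_compl !compA ind_mapE.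
Defined.

End Induction.

(* Main.v *)
(** The induction functor is left adjoint to restriction of scalars along [φ],
    so it is naturally full exactly when the unit [X -> X ⊗_R S] is a naturally
    split epimorphism.  A bimodule section [E] of [φ] provides such a splitting,
    [x ⊗ s ↦ x E(s)].  Conversely, the splitting at the regular module [R] is a
    right [R]-linear section of [φ]; by naturality it commutes with left
    multiplication by every global element [1 -> R], which amounts to left
    linearity when [1] is a left ⊗-generator. *)
From Stdlib Require Import ssreflect ssrfun.
Require Import Defs.
Local Open Scope cat_scope.

Set Implicit Arguments.
Unset Strict Implicit.
Unset Printing Implicit Defensive.

(** * Coherence of the left unit constraint *)

Lemma runit_epi (C : monoidal) (X : C) : epi (runit X).
Proof.
move=> Z g h e; rewrite -(compm1 g) -(compm1 h) -(runit_invK X) !compA.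
by rewrite e.
Qed.

Lemma lunit_epi (C : monoidal) (X : C) : epi (lunit X).
Proof.
move=> Z g h e; rewrite -(compm1 g) -(compm1 h) -(lunit_invK X) !compA.
by rewrite e.
Qed.

Lemma runit_tens_epi (C : monoidal) (X Y : C) : epi (runit X ⊗ₘ idm Y).
Proof.
move=> Z g h e; rewrite -(compm1 g) -(compm1 h) -tens_id -(runit_invK X).
by rewrite tens_compl !compA e.
Qed.

Lemma assoc_epi (C : monoidal) (X Y Z : C) : epi (assoc X Y Z).
Proof.
move=> W g h e; rewrite -(compm1 g) -(compm1 h) -(assoc_invK X Y Z) !compA.
by rewrite e.
Qed.

Lemma lunit_inv_nat (C : monoidal) (X Y : C) (f : hom X Y) :
  (idm (munit C) ⊗ₘ f) ∘ lunit_inv X = lunit_inv Y ∘ f.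
Proof.
apply: (@lunit_epi C).
by rewrite -!compA lunitK compm1 -lunit_nat compA lunitK comp1m.
Qed.

(** Kelly's argument, the mirror image of [runit_tens]: tensoring on the left with the unit object
    is faithful, and after tensoring the identity follows from the pentagon and two triangles. *)
Lemma lunit_tens (C : monoidal) (X Y : C) :
  lunit (X ⊗ Y) ∘ assoc (munit C) X Y = lunit X ⊗ₘ idm Y.
Proof.
have faithful (Z W : C) (f g : hom Z W) :
    idm (munit C) ⊗ₘ f = idm (munit C) ⊗ₘ g -> f = g.
  by move=> e; apply: (@lunit_epi C Z); rewrite -!lunit_nat e.
(* This composite is one leg of the pentagon; precomposing with it is harmless and lets [pentagon]
   apply. *)
have epi_assoc : epi (assoc (munit C) (munit C ⊗ X) Y
    ∘ (assoc (munit C) (munit C) X ⊗ₘ idm Y)).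
  move=> W g h; rewrite !compA => e.
  apply: (@assoc_epi C); rewrite -(compm1 (g ∘ _)) -(compm1 (h ∘ _)).
  by rewrite -tens_id -assoc_invK tens_compl !compA e.
apply: faithful; apply: epi_assoc.
rewrite tens_compr -[LHS]compA (compA (_ ⊗ₘ assoc _ _ _)) -pentagon compA.
rewrite triangle [RHS]compA -assoc_nat -[RHS]compA -tens_compl triangle.
by rewrite assoc_natl.
Qed.

Lemma assoc_lunit_inv (C : monoidal) (X Y : C) :
  assoc (munit C) X Y ∘ (lunit_inv X ⊗ₘ idm Y) = lunit_inv (X ⊗ Y).
Proof.
rewrite -[LHS]comp1m -lunitK -!compA (compA (lunit _)) lunit_tens.
by rewrite -tens_compl lunit_invK tens_id compm1.
Qed.

(** Both sides agree after tensoring with the unit object, by [triangle], [lunit_tens] and [lE]; the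
    latter is naturality of [lunit] at [lunit] itself, with [lunit] cancelled. *)
Lemma lunit_munit (C : monoidal) : lunit (munit C) = runit (munit C).
Proof.
have lE : lunit (munit C ⊗ munit C) = idm (munit C) ⊗ₘ lunit (munit C).
  rewrite -[LHS]comp1m -[RHS]comp1m -lunitK -!compA; congr (_ ∘ _).
  by rewrite lunit_nat.
apply: (@runit_epi C); rewrite -!runit_nat -triangle -lunit_tens lE.
by [].
Qed.

(** * Left multiplication by global elements of an algebra *)

Definition regular_rmodule (C : monoidal) (A : algebra C) : rmodule A :=
  RModule (mul_assoc A) (mul_oner A).

Lemma lmul_subproof (C : monoidal) (A : algebra C) (a : hom (munit C) A) :
  mul A ∘ (a ⊗ₘ idm (A : C)) ∘ lunit_inv A ∘ mul A
  = mul A ∘ ((mul A ∘ (a ⊗ₘ idm (A : C)) ∘ lunit_inv A) ⊗ₘ idm (A : C)).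
Proof.
rewrite !tens_compl !compA mul_assoc -!compA (compA (assoc _ _ _)) assoc_natl.
rewrite -(compA _ (assoc _ _ _)) assoc_lunit_inv (compA (idm _ ⊗ₘ mul A)).
by rewrite -tens_swap -!compA lunit_inv_nat.
Qed.

Definition lmul (C : monoidal) (A : algebra C) (a : hom (munit C) A) :
    rmod_hom (regular_rmodule A) (regular_rmodule A) :=
  @RModHom C A (regular_rmodule A) (regular_rmodule A) _ (lmul_subproof a).

Lemma lmul_one (C : monoidal) (A : algebra C) (a : hom (munit C) A) :
  lmul a ∘ one A = a.
Proof.
rewrite /= -compA -lunit_inv_nat compA -(compA (mul A)) tens_swap compA.
by rewrite mul_oner runit_nat -lunit_munit -compA lunit_invK compm1.
Qed.

(** * Restriction of scalars along φ *)

Section RestrictionOfScalars.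
Variables (C : monoidal) (R S : algebra C) (phi : alg_hom R S).

Lemma alg_map_runit : mul S ∘ (phi ⊗ₘ one S) = phi ∘ runit R.
Proof.
rewrite -runit_nat -mul_oner -compA -tens_comp.
by rewrite comp1m compm1.
Qed.

Lemma restr_rmodule_assoc (N : rmodule S) :
  ract N ∘ (idm (N : C) ⊗ₘ phi) ∘ ((ract N ∘ (idm (N : C) ⊗ₘ phi)) ⊗ₘ idm R)
  = ract N ∘ (idm (N : C) ⊗ₘ phi) ∘ (idm (N : C) ⊗ₘ mul R)
      ∘ assoc (N : C) R R.
Proof.
rewrite -(compA (ract N) _ (_ ⊗ₘ mul R)) -tens_compr alg_mapM tens_compr !compA.
rewrite -(compA _ _ (assoc _ R R)) -assoc_nat !compA -ract_assoc -!compA.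
by congr (_ ∘ _); rewrite -!tens_comp !comp1m !compm1.
Qed.

Lemma restr_rmodule_one (N : rmodule S) :
  ract N ∘ (idm (N : C) ⊗ₘ phi) ∘ (idm (N : C) ⊗ₘ one R) = runit (N : C).
Proof. by rewrite -compA -tens_compr alg_map1 ract_one. Qed.

Definition restr_rmodule (N : rmodule S) : rmodule R :=
  RModule (restr_rmodule_assoc N) (restr_rmodule_one N).

Lemma restr_rmod_map_subproof (M N : rmodule S) (g : rmod_hom M N) :
  g ∘ ract (restr_rmodule M) = ract (restr_rmodule N) ∘ (g ⊗ₘ idm R).
Proof.
by rewrite /= compA rmod_mapP -!compA tens_swap.
Qed.

Definition restr_rmod_map (M N : rmodule S) (g : rmod_hom M N) :
    rmod_hom (restr_rmodule M) (restr_rmodule N) :=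
  @RModHom C R (restr_rmodule M) (restr_rmodule N) g
    (restr_rmod_map_subproof g).

End RestrictionOfScalars.

(** Left linearity gives φE(φ(r)) = φE(r·1) = φ(r) φE(1) = φ(r), and the epimorphism φ can be
    cancelled. Precomposing with [runit] is what rewrites φ(r) as φ(r)·1. *)
Lemma split_of_split_one (C : monoidal) (R S : algebra C) (phi : alg_hom R S)
    (E : bimod_hom (restr_bimodule phi) (regular_bimodule R)) :
  epi phi -> phi ∘ E ∘ one S = one S -> phi ∘ E = idm (S : C).
Proof.
case: E => e /= el _ epi_phi e1; apply: epi_phi; apply: (@runit_epi C R).
rewrite comp1m -[LHS]compA -alg_map_runit.
have -> : mul S ∘ (phi ⊗ₘ one S)
    = mul S ∘ (phi ⊗ₘ idm (S : C)) ∘ (idm (R : C) ⊗ₘ one S).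
  by rewrite -compA -tens_comp comp1m compm1.
rewrite compA -(compA phi) el compA alg_mapM -!compA -!tens_comp.
by rewrite !comp1m compm1 compA e1.
Qed.

(** * The unit x ↦ x ⊗ 1 of the adjunction *)

Section Induction.
Variables (C : monoidal) (Q : has_coequalizers C) (cf : forall X : C, coflat X).
Variables (R S : algebra C) (phi : alg_hom R S).

Let tS (X : rmodule R) : C := tens_over Q X (restr_lmodule phi).
Let q (X : rmodule R) : hom ((X : C) ⊗ S) (tS X) :=
  tens_over_map Q X (restr_lmodule phi).
Let nu (X : rmodule R) : hom (tS X ⊗ S) (tS X) := ind_act Q cf phi X.

Let qE (X : rmodule R) : q X ∘ (ract X ⊗ₘ idm (S : C)) =
  q X ∘ (idm (X : C) ⊗ₘ (mul S ∘ (phi ⊗ₘ idm (S : C)))) ∘ assoc (X : C) R S.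
Proof. by rewrite -[RHS]compA; exact: (tens_overE Q X (restr_lmodule phi)). Qed.

Let nuE (X : rmodule R) : nu X ∘ (q X ⊗ₘ idm (S : C)) =
  q X ∘ (idm (X : C) ⊗ₘ mul S) ∘ assoc (X : C) S S.
Proof. exact: ind_actE. Qed.

Definition ind_unit_map (X : rmodule R) : hom (X : C) (tS X) :=
  q X ∘ (idm (X : C) ⊗ₘ one S) ∘ runit_inv X.

Lemma ind_unit_runit (X : rmodule R) :
  ind_unit_map X ∘ runit X = q X ∘ (idm (X : C) ⊗ₘ one S).
Proof. by rewrite -compA runitK compm1. Qed.

(** Since (x ⊗ 1)s = x ⊗ s, an S-linear map out of X ⊗_R S is determined by its composite with the
    unit. *)
Lemma ind_act_unit (X : rmodule R) :
  nu X ∘ (ind_unit_map X ⊗ₘ idm (S : C)) = q X.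
Proof.
apply: (@runit_tens_epi C); rewrite -compA -tens_compl ind_unit_runit.
rewrite tens_compl compA nuE -compA assoc_nat -triangle.
by rewrite !compA -(compA (q X)) -tens_compr mul_onel.
Qed.

(** Balancing over R: xr ⊗ 1 = x ⊗ φ(r). *)
Lemma ind_unit_act (X : rmodule R) :
  ind_unit_map X ∘ ract X = q X ∘ (idm (X : C) ⊗ₘ phi).
Proof.
apply: (@runit_epi C); rewrite -compA -runit_nat compA ind_unit_runit.
rewrite -compA -tens_swap compA qE -[LHS]compA assoc_natr -runit_tens.
rewrite !compA -!(compA (q X)) -!tens_compr -compA -tens_comp.
by rewrite comp1m compm1 alg_map_runit.
Qed.

Lemma ind_unit_mapP (X : rmodule R) :
  ind_unit_map X ∘ ract X =
  ract (restr_rmodule phi (ind_ob Q cf phi X)) ∘ (ind_unit_map X ⊗ₘ idm (R : C)).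
Proof.
rewrite ind_unit_act /= -[RHS]compA -tens_swap compA.
by rewrite [_ ∘ (ind_unit_map X ⊗ₘ _)]ind_act_unit.
Qed.

Definition ind_unit (X : rmodule R) :
    rmod_hom X (restr_rmodule phi (ind_ob Q cf phi X)) :=
  @RModHom C R X (restr_rmodule phi (ind_ob Q cf phi X)) _ (ind_unit_mapP X).

Lemma ind_unit_nat (X Y : rmodule R) (f : rmod_hom X Y) :
  ind_map Q phi f ∘ ind_unit X = ind_unit Y ∘ f.
Proof.
apply: (@runit_epi C) => /=; rewrite -!compA -(runit_nat f) runitK compm1.
rewrite (compA (runit_inv Y)) runitK comp1m compA [_ ∘ q X]ind_mapE -!compA.
by rewrite tens_swap.
Qed.

(** * Natural fullness from a bimodule section of φ *)

Section Splitting.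
Variable e : hom (S : C) R.
Hypothesis el : e ∘ (mul S ∘ (phi ⊗ₘ idm (S : C)))
  = mul R ∘ (idm (R : C) ⊗ₘ e).
Hypothesis er : e ∘ (mul S ∘ (idm (S : C) ⊗ₘ phi))
  = mul R ∘ (e ⊗ₘ idm (R : C)).

(** Left linearity of [e] makes y ⊗ s ↦ y e(s) balanced over R. *)
Lemma ind_split_coeq (Y : rmodule R) :
  ract Y ∘ (idm (Y : C) ⊗ₘ e) ∘ (ract Y ⊗ₘ idm (S : C))
  = ract Y ∘ (idm (Y : C) ⊗ₘ e)
      ∘ ((idm (Y : C) ⊗ₘ lact (restr_lmodule phi)) ∘ assoc (Y : C) R S).
Proof.
rewrite -compA -tens_swap compA ract_assoc -!compA assoc_natr.
by rewrite !compA -!(compA (ract Y)) -!tens_compr el.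
Qed.

Definition ind_split_map (Y : rmodule R) : hom (tS Y) Y :=
  coeq_desc (coeqP (tens_over Q Y (restr_lmodule phi))) (ind_split_coeq Y).

Lemma ind_splitE (Y : rmodule R) :
  ind_split_map Y ∘ q Y = ract Y ∘ (idm (Y : C) ⊗ₘ e).
Proof. exact: coeq_descE. Qed.

(** Right linearity of [e] gives y e(sφ(r)) = (y e(s))r. *)
Lemma ind_split_mapP (Y : rmodule R) :
  ind_split_map Y ∘ ract (restr_rmodule phi (ind_ob Q cf phi Y))
  = ract Y ∘ (ind_split_map Y ⊗ₘ idm (R : C)).
Proof.
apply: (@q_tens_epi C Q cf R S phi Y R).
rewrite -[RHS]compA -tens_compl ind_splitE tens_compl compA ract_assoc.
rewrite -[RHS]compA assoc_nat /= -!compA -tens_swap.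
rewrite (compA (ind_act _ _ _ _)) [ind_act _ _ _ _ ∘ _]nuE !compA.
rewrite ind_splitE -compA assoc_natr !compA -!(compA (ract Y)) -!tens_compr.
by rewrite -er -compA.
Qed.

Definition ind_split (Y : rmodule R) :
    rmod_hom (restr_rmodule phi (ind_ob Q cf phi Y)) Y :=
  @RModHom C R (restr_rmodule phi (ind_ob Q cf phi Y)) Y _ (ind_split_mapP Y).

Lemma ind_split_nat (X Y : rmodule R) (f : rmod_hom X Y) :
  ind_split Y ∘ ind_map Q phi f = f ∘ ind_split X.
Proof.
apply: (@q_epi C Q R S phi X); rewrite -!compA ind_mapE /= ind_splitE compA.
by rewrite ind_splitE compA rmod_mapP -!compA tens_swap.
Qed.

Hypothesis phi_e : phi ∘ e = idm (S : C).

(** This is where [phi_e] enters: y e(s) ⊗ t = y ⊗ φ(e(s))t = y ⊗ st. It expresses that the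
    splitting is a section of the unit. *)
Lemma ind_split_tens (Y : rmodule R) :
  q Y ∘ (ind_split Y ⊗ₘ idm (S : C)) = nu Y.
Proof.
apply: (@q_tens_epi C Q cf R S phi Y S).
rewrite [RHS]nuE /= -[LHS]compA -tens_compl ind_splitE tens_compl compA qE.
rewrite -[LHS]compA assoc_nat compA -(compA (q Y)) -tens_compr -(compA (mul S)).
by rewrite -tens_comp phi_e comp1m tens_id compm1.
Qed.

(** The adjunct x ↦ g(x ⊗ 1) of [g], pushed back into Y by the splitting. *)
Definition ind_preimage (X Y : rmodule R)
    (g : rmod_hom (ind_ob Q cf phi X) (ind_ob Q cf phi Y)) : rmod_hom X Y :=
  rmod_comp (ind_split Y) (rmod_comp (restr_rmod_map phi g) (ind_unit X)).

Lemma ind_preimage_nat (X X' Y Y' : rmodule R)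
    (h : rmod_hom X' X) (k : rmod_hom Y Y')
    (g : rmod_hom (ind_ob Q cf phi X) (ind_ob Q cf phi Y)) :
  ind_preimage (rmod_comp (rmod_comp (ind_hom Q cf phi k) g) (ind_hom Q cf phi h))
  = rmod_comp (rmod_comp k (ind_preimage g)) h.
Proof.
apply: rmod_hom_eq.
change (ind_split Y' ∘ (ind_map Q phi k ∘ g ∘ ind_map Q phi h ∘ ind_unit X')
  = k ∘ (ind_split Y ∘ (g ∘ ind_unit X)) ∘ h).
rewrite -[_ ∘ ind_unit X']compA ind_unit_nat !compA.
by rewrite ind_split_nat.
Qed.

(** By [ind_split_tens], x ⊗ s goes to g(x ⊗ 1)s, which is g(x ⊗ s) because [g] is S-linear. *)
Lemma ind_map_preimage (X Y : rmodule R)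
    (g : rmod_hom (ind_ob Q cf phi X) (ind_ob Q cf phi Y)) :
  ind_map Q phi (ind_preimage g) = g.
Proof.
apply: (@q_epi C Q R S phi X); rewrite [LHS]ind_mapE.
change (q Y ∘ ((ind_split Y ∘ (g ∘ ind_unit X)) ⊗ₘ idm (S : C)) = g ∘ q X).
rewrite tens_compl [(g ∘ _) ⊗ₘ _]tens_compl compA ind_split_tens compA.
rewrite -[nu Y ∘ _](rmod_mapP g) -compA.
by congr (_ ∘ _); apply: ind_act_unit.
Qed.

Lemma naturally_full_of_split : naturally_full (induction Q cf phi).
Proof.
exists ind_preimage; split; first exact: ind_preimage_nat.
by move=> X Y g; apply: rmod_hom_eq; apply: ind_map_preimage.
Qed.

End Splitting.

(** * A bimodule section of φ from natural fullness *)

Let Rr : rmodule R := regular_rmodule R.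
Let Sr : rmodule R := restr_rmodule phi (regular_rmodule S).

Lemma mul_coeq :
  mul S ∘ (ract Sr ⊗ₘ idm (S : C))
  = mul S ∘ ((idm (S : C) ⊗ₘ lact (restr_lmodule phi)) ∘ assoc (S : C) R S).
Proof.
rewrite /= tens_compl compA mul_assoc -!compA assoc_nat.
by rewrite tens_compr -!compA.
Qed.

(** The counit of the adjunction at S, s ⊗ t ↦ st. *)
Definition ind_counit_map : hom (tS Sr) S :=
  coeq_desc (coeqP (tens_over Q Sr (restr_lmodule phi))) mul_coeq.

Lemma ind_counitE : ind_counit_map ∘ q Sr = mul S.
Proof. exact: coeq_descE. Qed.

Lemma mul_map_coeq :
  mul S ∘ (phi ⊗ₘ idm (S : C)) ∘ (ract Rr ⊗ₘ idm (S : C))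
  = mul S ∘ (phi ⊗ₘ idm (S : C))
    ∘ ((idm (R : C) ⊗ₘ lact (restr_lmodule phi)) ∘ assoc (R : C) R S).
Proof. by rewrite [RHS]compA; apply: restr_lact_assoc. Qed.

(** The canonical isomorphism R ⊗_R S ≅ S, r ⊗ s ↦ φ(r)s, with inverse s ↦ 1 ⊗ s. *)
Definition ind_regular_map : hom (tS Rr) S :=
  coeq_desc (coeqP (tens_over Q Rr (restr_lmodule phi))) mul_map_coeq.

Lemma ind_regularE : ind_regular_map ∘ q Rr = mul S ∘ (phi ⊗ₘ idm (S : C)).
Proof. exact: coeq_descE. Qed.

Definition ind_regular_inv : hom (S : C) (tS Rr) :=
  q Rr ∘ (one R ⊗ₘ idm (S : C)) ∘ lunit_inv S.

Lemma ind_regular_invK : ind_regular_map ∘ ind_regular_inv = idm (S : C).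
Proof.
rewrite !compA ind_regularE -(compA (mul S)) -tens_compl alg_map1 mul_onel.
by rewrite lunit_invK.
Qed.

(** Balancing moves φ(r) across the tensor sign: 1 ⊗ φ(r)s = r ⊗ s. *)
Lemma ind_regular_invE :
  ind_regular_inv ∘ (mul S ∘ (phi ⊗ₘ idm (S : C))) = q Rr.
Proof.
rewrite -[LHS]compA -lunit_inv_nat -[LHS]compA (compA (one R ⊗ₘ _)) tens_swap.
rewrite -assoc_lunit_inv -!compA (compA (one R ⊗ₘ _)) -assoc_natl !compA.
have <- := qE Rr.
by rewrite -!(compA (q Rr)) -!tens_compl mul_onel lunit_invK tens_id compm1.
Qed.

Lemma ind_regular_inv_act :
  nu Rr ∘ (ind_regular_inv ⊗ₘ idm (S : C)) = ind_regular_inv ∘ mul S.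
Proof.
rewrite !tens_compl !compA nuE -!compA (compA (assoc _ _ _)) assoc_natl.
rewrite -(compA _ (assoc _ _ _)) assoc_lunit_inv (compA (idm _ ⊗ₘ mul S)).
by rewrite -tens_swap -!compA lunit_inv_nat.
Qed.

Lemma ind_counit_act :
  ind_counit_map ∘ nu Sr = mul S ∘ (ind_counit_map ⊗ₘ idm (S : C)).
Proof.
apply: (@q_tens_epi C Q cf R S phi Sr S).
rewrite -[RHS]compA -tens_compl ind_counitE mul_assoc -[LHS]compA [nu Sr ∘ _]nuE.
by rewrite !compA ind_counitE.
Qed.

Lemma ind_counit_regular_act :
  (ind_regular_inv ∘ ind_counit_map) ∘ ract (ind_ob Q cf phi Sr)
  = ract (ind_ob Q cf phi Rr)
    ∘ ((ind_regular_inv ∘ ind_counit_map) ⊗ₘ idm (S : C)).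
Proof.
rewrite tens_compl compA [_ ∘ (ind_regular_inv ⊗ₘ _)]ind_regular_inv_act.
by rewrite -[LHS]compA -[RHS]compA; congr (_ ∘ _); apply: ind_counit_act.
Qed.

(* s ⊗ t ↦ 1 ⊗ s t *)
Definition ind_counit_regular :
    rmod_hom (ind_ob Q cf phi Sr) (ind_ob Q cf phi Rr) :=
  @RModHom C S (ind_ob Q cf phi Sr) (ind_ob Q cf phi Rr) _
    ind_counit_regular_act.

Lemma ind_counit_regularE :
  ind_counit_regular ∘ q Sr = ind_regular_inv ∘ mul S.
Proof. by rewrite -[LHS]compA ind_counitE. Qed.

(** The hypothesis reads E(s) ⊗ t = 1 ⊗ st. Under R ⊗_R S ≅ S it becomes φ(E(s))t = st, and t = 1
    gives the claim. *)
Lemma section_of_ind_counit_regular (E : rmod_hom Sr Rr) :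
  ind_map Q phi E = ind_counit_regular -> phi ∘ E = idm (S : C).
Proof.
move=> EE.
have qEE : q Rr ∘ (E ⊗ₘ idm (S : C)) = ind_regular_inv ∘ mul S.
  by rewrite -[LHS]ind_mapE EE ind_counit_regularE.
have mulE : mul S ∘ ((phi ∘ E) ⊗ₘ idm (S : C)) = mul S.
  rewrite tens_compl compA -ind_regularE -compA qEE [LHS]compA.
  by rewrite ind_regular_invK comp1m.
apply: (@runit_epi C); rewrite comp1m -runit_nat -mul_oner.
by rewrite -[LHS]compA -tens_swap compA mulE.
Qed.

(** Both sides send s to r ⊗ s = 1 ⊗ φ(r)s. *)
Lemma ind_regular_inv_lmul (r : hom (munit C) R) :
  ind_map Q phi (lmul r) ∘ ind_regular_inv = ind_regular_inv ∘ lmul (phi ∘ r).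
Proof.
transitivity (q Rr ∘ (r ⊗ₘ idm (S : C)) ∘ lunit_inv S).
  rewrite [LHS]compA; congr (_ ∘ _); rewrite [LHS]compA [_ ∘ q Rr]ind_mapE.
  by rewrite -[LHS]compA -tens_compl lmul_one.
by rewrite -ind_regular_invE /= tens_compl -!compA.
Qed.

(** Both sides send s ⊗ t to 1 ⊗ φ(r)st. This commuting square is what naturality of a right inverse
    of induction carries back to modules over R. *)
Lemma ind_counit_regular_lmul (r : hom (munit C) R) :
  ind_map Q phi (lmul r) ∘ ind_counit_regular
  = ind_counit_regular ∘ ind_map Q phi (restr_rmod_map phi (lmul (phi ∘ r))).
Proof.
apply: (@q_epi C Q R S phi Sr).
rewrite -[LHS]compA ind_counit_regularE.
rewrite -[RHS]compA ind_mapE [RHS]compA ind_counit_regularE.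
rewrite [LHS]compA ind_regular_inv_lmul -[LHS]compA -[RHS]compA.
by congr (_ ∘ _); apply: (rmod_mapP (lmul (phi ∘ r))).
Qed.

Lemma split_of_naturally_full :
  left_tensor_generator (munit C) -> naturally_full (induction Q cf phi) ->
  exists E : bimod_hom (restr_bimodule phi) (regular_bimodule R),
    phi ∘ E = idm (S : C).
Proof.
move=> gen [P [Pnat PK]].
pose E : rmod_hom Sr Rr := P Sr Rr ind_counit_regular.
have phiE : phi ∘ E = idm (S : C).
  apply: section_of_ind_counit_regular.
  exact: (f_equal (@rmod_map _ _ _ _) (PK Sr Rr ind_counit_regular)).
(* E(φ(r)s) = r E(s) for global elements r: naturality of [P] in the target ([Pl]) and in the source
   ([Pr]) evaluates [P] at the two sides of [ind_counit_regular_lmul]. *)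
have lmulE (r : hom (munit C) R) :
    lmul r ∘ E = E ∘ restr_rmod_map phi (lmul (phi ∘ r)).
  have Pl := Pnat Sr Sr Rr Rr (@idm (rmodules R) Sr) (lmul r) ind_counit_regular.
  have Pr := Pnat Sr Sr Rr Rr (restr_rmod_map phi (lmul (phi ∘ r)))
    (@idm (rmodules R) Rr) ind_counit_regular.
  rewrite fmap1 !compm1 in Pl; rewrite fmap1 !comp1m in Pr.
  apply: (f_equal (@rmod_map _ _ _ _) (etrans (esym Pl) (etrans _ Pr))).
  by congr (P _ _ _); apply: rmod_hom_eq; apply: ind_counit_regular_lmul.
have El : E ∘ (mul S ∘ (phi ⊗ₘ idm (S : C))) = mul R ∘ (idm (R : C) ⊗ₘ E).
  (* The generator hypothesis reduces left linearity to global elements r, where it is [lmulE] up to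
     the unit constraint. *)
  apply: gen => r; rewrite -[RHS]compA -tens_swap.
  rewrite -!compA -tens_compl.
  have := f_equal (fun h => h ∘ lunit S) (lmulE r).
  rewrite /= -!compA lunitK compm1 => <-.
  by rewrite -lunit_nat (compA (lunit_inv R)) lunitK comp1m.
by exists (@BimodHom C R R (restr_bimodule phi) (regular_bimodule R) E El
  (rmod_mapP E)).
Qed.

End Induction.

Theorem proposition3p7 (C : monoidal) (Q : has_coequalizers C)
    (flat : forall X : C, coflat X) (R S : algebra C) (phi : alg_hom R S) :
  let i := exists E : bimod_hom (restr_bimodule phi) (regular_bimodule R),
    phi ∘ E = idm (S : C) in
  let ii := epi phi /\
    exists E : bimod_hom (restr_bimodule phi) (regular_bimodule R),
      phi ∘ E ∘ one S = one S in
  let iii := naturally_full (induction Q flat phi) in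
  (i <-> ii) /\
  (i \/ ii -> iii) /\
  (left_tensor_generator (munit C) -> (iii <-> i) /\ (iii <-> ii)).
Proof.
move=> i ii iii.
have i_ii : i <-> ii.
  split=> [[E phiE]|[epi_phi [E E1]]].
    split; last by exists E; rewrite phiE comp1m.
    by move=> Z g h e; rewrite -(compm1 g) -(compm1 h) -phiE !compA e.
  by exists E; apply: split_of_split_one.
have i_iii : i -> iii.
  move=> [E phiE].
  exact: naturally_full_of_split (bimod_mapl E) (bimod_mapr E) phiE.
split=> //; split; first by case=> [|/i_ii]; apply: i_iii.
move=> gen; have iii_i : iii -> i by apply: split_of_naturally_full.
by split; split=> // [/iii_i/i_ii|/i_ii].
Qed.
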